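(* Let $\lambda>0$, $t\in\mathbb{R}$, and let $P_n(x)=P_n(x;t)$, $n=0,1,2,\ldots$, be the monic semi-classical Laguerre polynomials, i.e. the monic orthogonal polynomials with respect to $w(x;t)=x^\lambda e^{-x^2+tx}$ on $(0,\infty)$, with recurrence coefficients $\alpha_n=\alpha_n(t)$, $\beta_n=\beta_n(t)$. Then $P_n$ satisfies the linear second-order ordinary differential equation (with $'=d/dx$) $$P_n''(x)+\Phi(x)P_n'(x)+\Psi(x)P_n(x)=0,$$ where $$\Phi(x)=t-2x+\frac{\lambda}{x}-\frac{t-2\alpha_n}{x(2x-t+2\alpha_n)},$$ $$\Psi(x)=2n-\frac{nt-4\alpha_n\beta_n}{x}-\frac{2(n-2\beta_n)(n+\lambda-2\beta_n)}{x(t-2\alpha_n)}+\frac{n-2\beta_n}{x^2}+\frac{(t-2\alpha_n)(n-2\beta_n)}{x^2(2x-t+2\alpha_n)}.$$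
   Context: For $\lambda>0$ and $t\in\mathbb{R}$, let $w(x;t)=x^\lambda e^{-x^2+tx}$ for $x\in(0,\infty)$. $P_n(x;t)$ is the monic polynomial of degree $n$ in $x$ with $\int_0^\infty P_m(x;t)P_n(x;t)w(x;t)\,dx=h_n(t)\delta_{mn}$ for $m,n\ge 0$. The recurrence coefficients $\alpha_n(t),\beta_n(t)$ are defined by the three-term recurrence relation $xP_n(x;t)=P_{n+1}(x;t)+\alpha_n(t)P_n(x;t)+\beta_n(t)P_{n-1}(x;t)$ with $P_0=1$ and $\beta_0P_{-1}=0$ (convention $\beta_0=0$); for $n\ge1$, $\beta_n=h_n/h_{n-1}$. *)

(* Defs.v *)
(* MathComp / MathComp-Analysis, over an arbitrary [R : realType]. *)
From HB Require Import structures.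
From mathcomp Require Import all_boot all_order all_algebra.
From mathcomp Require Import all_classical all_reals all_analysis.

Set Implicit Arguments.
Unset Strict Implicit.
Unset Printing Implicit Defensive.

Import Order.TTheory GRing.Theory Num.Theory.
Import numFieldNormedType.Exports.

Local Open Scope classical_set_scope.
Local Open Scope ring_scope.

(* Only used on ]0, +oo[, where [x `^ lambda] is the usual real power. *)
Definition laguerre_weight (R : realType) (lambda t x : R) : R :=
  x `^ lambda * expR (- x ^+ 2 + t * x).

(* [\int] is [+oo]- or [-oo]-valued when the positive or negative part of the
   integrand has an infinite integral, so the finite right-hand side includes
   the convergence of the integrals. *)
Definition monic_orthogonal (R : realType) (w : R -> R)
    (P : nat -> {poly R}) (h : nat -> R) : Prop :=
  (forall n, P n \is monic /\ size (P n) = n.+1) /\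
  (forall m n,
     (\int[@lebesgue_measure R]_(x in `]0%R, +oo[)
        ((P m).[x] * (P n).[x] * w x)%:E
      = (if m == n then h n else 0)%:E)%E).

(* The case [n = 0] is stated apart: it has no term in P_(-1). *)
Definition three_term_recurrence (R : realType)
    (P : nat -> {poly R}) (alpha beta : nat -> R) : Prop :=
  [/\ beta 0%N = 0,
      'X * P 0%N = P 1%N + alpha 0%N *: P 0%N &
      forall n, 'X * P n.+1
                = P n.+2 + alpha n.+1 *: P n.+1 + beta n.+1 *: P n].

Definition Phi (R : realType) (lambda t : R) (alpha : nat -> R)
    (n : nat) (x : R) : R :=
  t - 2 * x + lambda / x
  - (t - 2 * alpha n) / (x * (2 * x - t + 2 * alpha n)).

Definition Psi (R : realType) (lambda t : R) (alpha beta : nat -> R)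
    (n : nat) (x : R) : R :=
  2 * n%:R
  - (n%:R * t - 4 * alpha n * beta n) / x
  - (2 * (n%:R - 2 * beta n) * (n%:R + lambda - 2 * beta n))
      / (x * (t - 2 * alpha n))
  + (n%:R - 2 * beta n) / x ^+ 2
  + ((t - 2 * alpha n) * (n%:R - 2 * beta n))
      / (x ^+ 2 * (2 * x - t + 2 * alpha n)).

(* Main.v *)
Require Import Defs.
From HB Require Import structures.
From mathcomp Require Import all_boot all_order all_algebra.
From mathcomp Require Import all_classical all_reals all_analysis.
From mathcomp Require Import measurable_realfun.
From mathcomp Require Import ring lra.
From mathcomp Require polyrcf.

Import Order.TTheory GRing.Theory Num.Theory.
Import numFieldNormedType.Exports.

Local Open Scope classical_set_scope.
Local Open Scope ring_scope.

(** Write w(x) = x^lambda e^(-x^2 + t x), L(q) for the integral of q w over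
    (0, oo), a_n = 2 alpha_n - t, A_n(x) = 2 x + a_n and B_n = n - 2 beta_n.

    Everything starts from the logarithmic derivative of w: for a polynomial q,
    (q w)' = (q' + (lambda/x + t - 2 x) q) w.  As q w vanishes at both ends of
    (0, oo), integrating this identity on [1/(k+1), k+2] and letting k grow
    (lemma weight_derivative_cvg0) has two consequences.
    - With x q for q, the integrand is a polynomial times w, and L annihilates
      x q' + (1 + lambda + t x - 2 x^2) q (lemma pearson).
    - With p^2 for q, where p is monic, the term lambda p^2 / x is nonnegative
      and has an integral bounded away from 0, so
      L((p^2)' + (t - 2 x) p^2) < 0 (lemma moment_square_lt0).  For p = P_n
      the left-hand side is (t - 2 alpha_n) h_n by orthogonality, so neither
      t - 2 alpha_n nor h_n is zero.
    Polynomials are integrable against w because the P_n are, which is part of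
    what the orthogonality hypothesis says (lemma integrable_poly_weight).

    The rest is algebra on the functional L.  The relation of lemma pearson
    determines L(x P_n' P_m) for m < n, hence the expansion of x P_n' in the
    P_m, whose leading term is n P_n.  It involves P_n, P_(n-1) and P_(n-2),
    and the recurrence removes the last one:
      x P_n' = B_n P_n + beta_n A_n P_(n-1)        (lemma lowering_equation).
    Eliminating P_(n-1) instead, with the help of the value of L(x P_n' P_n)
    (lemma string_equation), gives
      x P_n' = (2 x^2 - t x - lambda - B_(n+1)) P_n - A_n P_(n+1)
                                                   (lemma raising_equation).
    Differentiating the first equation and replacing P_(n-1)' and P_(n-1) by
    means of the two equations leaves a second-order equation for P_n, in which
    alpha_(n-1) occurs only through beta_n a_n a_(n-1).  At x = 0 the two
    equations form a homogeneous linear system with the nonzero solution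
    (P_n(0), P_(n-1)(0)), so its determinant vanishes:
      beta_n a_n a_(n-1) = B_n (B_n + lambda)      (lemma beta_string).
    This removes alpha_(n-1) and gives the stated coefficients. *)

(** * Orthogonal polynomials for a linear functional *)

Section orthogonal.
Context {R : realType}.
Variables (L : {scalar {poly R}}) (P : nat -> {poly R}) (h : nat -> R).
Hypothesis P_monic : forall n, P n \is monic /\ size (P n) = n.+1.
Hypothesis P_orth : forall m n, L (P m * P n) = if m == n then h n else 0.

Lemma coef_monic_seq n j : (n <= j)%N -> (P n)`_j = (j == n)%:R.
Proof.
have [/monicP lP sP] := P_monic n.
rewrite leq_eqVlt => /predU1P[<-|nj]; last by rewrite gtn_eqF// nth_default ?sP.
by rewrite eqxx -[RHS]lP lead_coefE sP.
Qed.

Lemma size_deriv_monic_seq n : (size (P n)^`() <= n)%N.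
Proof.
have [mP sP] := P_monic n.
by rewrite -ltnS -sP lt_size_deriv// monic_neq0.
Qed.

Lemma size_sub_monic_seq n (q : {poly R}) : (size q <= n.+1)%N ->
  (size (q - q`_n *: P n)%R <= n)%N.
Proof.
move=> sq; apply/leq_sizeP => j nj; rewrite coefB coefZ coef_monic_seq//.
case: eqVneq => [->|jn]; first by rewrite mulr1 subrr.
by rewrite mulr0 subr0 nth_default// (leq_trans sq)// ltn_neqAle eq_sym jn.
Qed.

Lemma orth_lower n (q : {poly R}) : (size q <= n)%N -> L (P n * q) = 0.
Proof.
suff H k : (k <= n)%N ->
  forall q : {poly R}, (size q <= k)%N -> L (P n * q) = 0.
  exact: H.
elim: k => [_ {}q|k IH kn {}q sq].
  by rewrite size_poly_leq0 => /eqP ->; rewrite mulr0 linear0.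
rewrite -[q](subrK (q`_k *: P k)) mulrDr (linearD L)/=.
rewrite -scalerAr (scalarZ L)/= P_orth.
rewrite IH ?size_sub_monic_seq// ?(ltnW kn)//.
by rewrite gtn_eqF// mulr0 addr0.
Qed.

Lemma orth_top n (q : {poly R}) : (size q <= n.+1)%N ->
  L (P n * q) = q`_n * h n.
Proof.
move=> sq; rewrite -[q in LHS](subrK (q`_n *: P n)) mulrDr (linearD L)/=.
rewrite orth_lower ?size_sub_monic_seq// add0r.
by rewrite -scalerAr (scalarZ L)/= P_orth eqxx.
Qed.

Hypothesis h_neq0 : forall n, h n != 0.

(** Nondegeneracy: a polynomial of degree below n is a combination of the P_m
    with m < n, with coefficients L(P_m q) / h_m.  It reduces a polynomial
    identity to values of L. *)
Lemma orth_eq0 n (q : {poly R}) : (size q <= n)%N ->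
  (forall m, (m < n)%N -> L (P m * q) = 0) -> q = 0.
Proof.
elim: n => [|n IH] sq Lq; first by apply/eqP; rewrite -size_poly_leq0.
have := Lq n (ltnSn n).
rewrite orth_top// => /eqP; rewrite mulf_eq0 (negPf (h_neq0 n)) orbF => /eqP q0.
apply: IH => [|m mn]; last by rewrite Lq// (ltn_trans mn).
by have := size_sub_monic_seq n q sq; rewrite q0 scale0r subr0.
Qed.

Variables alpha beta : nat -> R.
Hypothesis P_rec : three_term_recurrence P alpha beta.

(** The product beta_n P_(n-1), equal to 0 for n = 0, gives the recurrence one
    form for all n. *)
Definition recurrence_tail n : {poly R} :=
  if n is m.+1 then beta n *: P m else 0.

Lemma recurrence n : 'X * P n = P n.+1 + alpha n *: P n + recurrence_tail n.
Proof. by case: P_rec => _ r0 rS; case: n => [|n] /=; rewrite ?addr0. Qed.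

Lemma size_recurrence_tail n : (size (recurrence_tail n) <= n)%N.
Proof.
case: n => [|n] /=; first by rewrite size_poly0.
by rewrite (leq_trans (size_scale_leq _ _))// (P_monic n).2.
Qed.

Lemma size_mulX n (q : {poly R}) : (size q <= n)%N ->
  (size ('X * q)%R <= n.+1)%N.
Proof.
move=> sq; apply/leq_sizeP => -[//|j] nj; rewrite coefXM/= nth_default//.
exact: leq_trans sq _.
Qed.

Lemma h_beta n : h n.+1 = beta n.+1 * h n.
Proof.
have : L (P n * ('X * P n.+1)) = beta n.+1 * h n.
  rewrite recurrence /= !mulrDr !(linearD L)/= -!scalerAr !(scalarZ L)/=.
  rewrite !P_orth eqxx.
  by rewrite !ltn_eqF ?mulr0 ?add0r// ltnW.
move=> <-; rewrite mulrCA mulrA mulrC orth_top; last first.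
  by apply: size_mulX; rewrite (P_monic n).2.
by rewrite coefXM/= coef_monic_seq// eqxx mul1r.
Qed.

Lemma L_XPP n : L ('X * P n * P n) = alpha n * h n.
Proof.
rewrite recurrence !mulrDl !(linearD L)/= -!scalerAl (scalarZ L)/=.
rewrite !P_orth eqxx gtn_eqF//.
rewrite [recurrence_tail n * _]mulrC orth_lower ?size_recurrence_tail//.
by rewrite add0r addr0.
Qed.

(** Write x^2 P_n^2 as (x P_n) (x P_n), expand one factor by the recurrence, and
    read the two outer terms off leading coefficients. *)
Lemma L_X2PP n :
  L ('X ^+ 2 * P n * P n) = (beta n.+1 + alpha n ^+ 2 + beta n) * h n.
Proof.
have -> : 'X ^+ 2 * P n * P n = ('X * P n) * ('X * P n) by ring.
have LS : L (P n.+1 * ('X * P n)) = h n.+1.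
  rewrite orth_top; last by apply: size_mulX; rewrite (P_monic n).2.
  by rewrite coefXM/= coef_monic_seq// eqxx mul1r.
have L0 : L (recurrence_tail n * ('X * P n)) = beta n * h n.
  have -> : recurrence_tail n * ('X * P n) = P n * ('X * recurrence_tail n).
    by ring.
  rewrite orth_top ?size_mulX ?size_recurrence_tail// coefXM.
  case: n {LS} => [|n] /=.
    by have [-> _ _] := P_rec.
  by rewrite coefZ coef_monic_seq// eqxx mulr1.
rewrite {1}recurrence [in LHS]mulrDl [in LHS]mulrDl !(linearD L)/=.
rewrite -[in LHS]scalerAl (scalarZ L)/= LS L0.
rewrite [P n * _]mulrC L_XPP h_beta; ring.
Qed.

(** * Consequences of the Pearson relation *)

Variables lambda t : R.

(** The derivative of P_n ^ 2 is 2 P_n P_n', which L annihilates. *)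
Lemma L_square_derivative n :
  L ((P n ^+ 2)^`() + (t%:P - 2 *: 'X) * P n ^+ 2) = (t - 2 * alpha n) * h n.
Proof.
have -> : (P n ^+ 2)^`() + (t%:P - 2 *: 'X) * P n ^+ 2
  = 2 *: (P n * (P n)^`()) + t *: (P n * P n) - 2 *: ('X * P n * P n).
  by rewrite expr2 poly.derivM !scaler_nat -!mul_polyC; ring.
rewrite !(linearB L, linearD L, scalarZ L)/= L_XPP P_orth eqxx.
by rewrite orth_lower ?size_deriv_monic_seq//; ring.
Qed.

Hypothesis L_pearson : forall q : {poly R},
  L ('X * q^`() + ((1 + lambda)%:P + t *: 'X - 2 *: 'X ^+ 2) * q) = 0.

(** The Pearson relation for q = P_n ^ 2: the derivative contributes 2 n h_n,
    because x P_n' has leading coefficient n. *)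
Lemma string_equation n :
  2 * n%:R + 1 + lambda
  = 2 * beta n + 2 * beta n.+1 + alpha n * (2 * alpha n - t).
Proof.
have LXd : L (P n * ('X * (P n)^`())) = n%:R * h n.
  rewrite orth_top ?size_mulX ?size_deriv_monic_seq//.
  rewrite coefXM; case: n => [|n] /=; first by [].
  by rewrite coef_deriv coef_monic_seq// eqxx.
have := L_pearson (P n * P n).
have -> : 'X * (P n * P n)^`() +
     ((1 + lambda)%:P + t *: 'X - 2 *: 'X ^+ 2) * (P n * P n)
   = 2 *: (P n * ('X * (P n)^`())) + (1 + lambda) *: (P n * P n)
     + t *: ('X * P n * P n) - 2 *: ('X ^+ 2 * P n * P n).
  by rewrite poly.derivM -!mul_polyC; ring.
rewrite !(linearB L, linearD L, scalarZ L)/= LXd L_XPP L_X2PP P_orth eqxx => E.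
apply: (mulIf (h_neq0 n)); rewrite -[LHS]addr0 -[X in _ + X]oppr0 -E; ring.
Qed.

(** The difference q of the two sides has degree at most n, and is orthogonal
    to P_m for m <= n: the Pearson relation for P_(n+1) P_m evaluates
    L(x P_(n+1)' P_m), since the companion term P_(n+1) x P_m' is annihilated
    for degree reasons.  Expanding x P_(n+1) by the recurrence inside
    x^2 P_(n+1) P_m produces no polynomial of index n - 1, so that the case
    n = 0 is not special. *)
Lemma lowering_equation n : 'X * (P n.+1)^`()
  = (n.+1%:R - 2 * beta n.+1) *: P n.+1
    + beta n.+1 *: ((2 *: 'X + (2 * alpha n.+1 - t)%:P) * P n).
Proof.
apply/eqP; rewrite -subr_eq0; apply/eqP.
set q := (X in X = 0); set b := beta n.+1; set a := alpha n.+1.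
have sq : (size q <= n.+1)%N.
  (* The coefficients of degree n + 1 cancel: B + 2 beta = n + 1. *)
  apply/leq_sizeP => -[//|j] nj; rewrite /q [(_ + _%:P) * _]mulrDl.
  rewrite -scalerAl mul_polyC.
  rewrite coefB coefD !coefZ coefD !coefZ !coefXM/= coef_deriv.
  rewrite ltnS in nj.
  rewrite (coef_monic_seq n.+1)// (coef_monic_seq n)// coef_monic_seq 1?ltnW//.
  rewrite eqSS; case: (eqVneq j n) => [->|jn]; last first.
    by rewrite (@gtn_eqF n j.+1)// mulr0n mul0rn; ring.
  by rewrite (@gtn_eqF n n.+1)// mulr1n mulr0n; ring.
apply: (orth_eq0 n.+1) => // m; rewrite ltnS => mn.
have LXd : L ('X * (P n.+1)^`() * P m)
     = 2 * L ('X ^+ 2 * P n.+1 * P m) - t * L ('X * P n.+1 * P m).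
  have := L_pearson (P n.+1 * P m).
  have -> : 'X * (P n.+1 * P m)^`() +
     ((1 + lambda)%:P + t *: 'X - 2 *: 'X ^+ 2) * (P n.+1 * P m)
    = 'X * (P n.+1)^`() * P m + P n.+1 * ('X * (P m)^`())
     + (1 + lambda) *: (P n.+1 * P m)
     + t *: ('X * P n.+1 * P m) - 2 *: ('X ^+ 2 * P n.+1 * P m).
    by rewrite poly.derivM -!mul_polyC; ring.
  rewrite !(linearB L, linearD L, scalarZ L)/= P_orth gtn_eqF//.
  rewrite orth_lower; last first.
    by apply: size_mulX; rewrite (leq_trans (size_deriv_monic_seq m)).
  move=> E; rewrite -[LHS]subr0 -E; ring.
have -> : P m * q = 'X * (P n.+1)^`() * P m
   - (n.+1%:R - 2 * b) *: (P n.+1 * P m)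
   - (2 * b) *: ('X * P n * P m) - (b * (2 * a - t)) *: (P n * P m).
  by rewrite /q -/b -/a -!mul_polyC !(polyCM, polyCB); ring.
rewrite !(linearB L, linearD L, scalarZ L)/= LXd !P_orth gtn_eqF// mulr0 subr0.
have LXP : L ('X * P n.+1 * P m) = b * (if n == m then h m else 0).
  rewrite recurrence/= !mulrDl -!scalerAl !(linearD L)/= !(scalarZ L)/=.
  rewrite !P_orth (@gtn_eqF m n.+2) ?(@gtn_eqF m n.+1) ?ltnS ?leqW//.
  by rewrite mulr0 !add0r.
have LX2P : L ('X ^+ 2 * P n.+1 * P m)
     = a * L ('X * P n.+1 * P m) + b * L ('X * P n * P m).
  have -> : 'X ^+ 2 * P n.+1 * P m = 'X * P n.+1 * ('X * P m) by ring.
  rewrite [in LHS]recurrence/= !mulrDl !(linearD L)/= -!scalerAl !(scalarZ L)/=.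
  rewrite orth_lower; last by apply: size_mulX; rewrite (P_monic m).2.
  by rewrite add0r !(mulrA, mulrC _ 'X).
rewrite LX2P LXP; ring.
Qed.

(** Lowering, with beta_n P_(n-1) rewritten as (x - alpha_n) P_n - P_(n+1); the
    string equation simplifies the constant coefficient. *)
Lemma raising_equation n : 'X * (P n)^`()
  = (2 *: 'X ^+ 2 - t *: 'X - (lambda + n.+1%:R - 2 * beta n.+1)%:P) * P n
    - (2 *: 'X + (2 * alpha n - t)%:P) * P n.+1.
Proof.
have -> : 'X * (P n)^`() = (n%:R - 2 * beta n) *: P n
   + (2 *: 'X + (2 * alpha n - t)%:P) * recurrence_tail n.
  case: n => [|n] /=; last by rewrite lowering_equation -scalerAr.
  have [b0 _ _] := P_rec; rewrite b0 mulr0 subr0 scale0r mulr0 addr0.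
  have -> : (P 0)^`() = 0.
    by apply/eqP; rewrite -size_poly_leq0 size_deriv_monic_seq.
  by rewrite mulr0.
have -> : recurrence_tail n = 'X * P n - P n.+1 - alpha n *: P n.
  by rewrite recurrence; ring.
have -> : lambda + n.+1%:R - 2 * beta n.+1
   = 2 * beta n - n%:R + alpha n * (2 * alpha n - t).
  by have := string_equation n; rewrite -[n.+1]addn1 natrD; lra.
by rewrite -!mul_polyC !(polyCM, polyCD, polyCB); ring.
Qed.

(** Since every beta_n is nonzero, a common root would descend along the
    recurrence to P_0 = 1. *)
Lemma consecutive_roots n x : root (P n) x -> root (P n.+1) x -> False.
Proof.
elim: n => [|n IH] /rootP r0 /rootP r1.
  move: r0; have [/monicP + s0] := P_monic 0%N.
  rewrite (size1_polyC (eq_leq s0)) lead_coefC hornerC => -> /eqP.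
  by rewrite oner_eq0.
apply: IH; last exact/rootP.
have := congr1 (horner^~ x) (recurrence n.+1); rewrite /= !hornerE r0 r1.
rewrite !(mulr0, add0r) => /esym/eqP; rewrite mulf_eq0 => /orP[b0|]; last by [].
by move: (h_neq0 n.+1); rewrite h_beta (eqP b0) mul0r eqxx.
Qed.

(** At 0 the lowering and raising equations are a homogeneous linear system in
    P_(n+1)(0) and P_n(0).  These are not both zero, so its determinant
    vanishes. *)
Lemma beta_string n :
  beta n.+1 * (2 * alpha n.+1 - t) * (2 * alpha n - t)
  = (n.+1%:R - 2 * beta n.+1) * (n.+1%:R - 2 * beta n.+1 + lambda).
Proof.
have := congr1 (horner^~ 0) (raising_equation n).
have := congr1 (horner^~ 0) (lowering_equation n).
rewrite /= !hornerE/=.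
set p := (P n.+1).[0]; set q := (P n).[0]; set b := beta n.+1.
set a := 2 * _ - t; set a' := 2 * _ - t; set B := _ - 2 * b.
move=> /esym; set u := (X in X = 0) => u0 /esym; set v := (X in X = 0) => v0.
apply/eqP; rewrite -subr_eq0; set d := _ - _.
(* Cramer's rule: d is the determinant, u = v = 0 are the equations. *)
have dp : d * p = - (B + lambda) * u - b * a * v by rewrite /d /u /v /B; ring.
have dq : d * q = a' * u + B * v by rewrite /d /u /v /B; ring.
move: dp dq; rewrite u0 v0 !mulr0 subr0 addr0 => dp dq.
apply/negP => /negP d0; move/eqP: dp; move/eqP: dq.
rewrite !mulf_eq0 (negPf d0)/= => q0 p0.
exact: (consecutive_roots n 0).
Qed.

Lemma second_order_equation n x : t - 2 * alpha n != 0 -> x != 0 ->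
   2 * x - t + 2 * alpha n != 0 ->
    (P n)^`()^`().[x]
    + Phi lambda t alpha n x * (P n)^`().[x]
    + Psi lambda t alpha beta n x * (P n).[x] = 0.
Proof.
case: n => [|n] a0 x0 A0; rewrite /Phi /Psi.
  have [b0 _ _] := P_rec.
  have -> : (P 0)^`() = 0.
    by apply/eqP; rewrite -size_poly_leq0 size_deriv_monic_seq.
  by rewrite deriv0 horner0 b0 !(mulr0, mul0r, subr0, addr0).
have := congr1 (horner^~ x) (lowering_equation n).
have := congr1 (fun p => p^`().[x]) (lowering_equation n).
have := congr1 (horner^~ x) (raising_equation n).
have := beta_string n.
rewrite /= !poly.derivE !hornerE/=.
set p := (P n.+1).[x]; set p' := (P n.+1)^`().[x].
set p'' := (P n.+1)^`()^`().[x]; set q := (P n).[x]; set q' := (P n)^`().[x].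
set b := beta n.+1; set a := alpha n.+1 in a0 A0 *; set c := alpha n.
set N := n.+1%:R.
move=> E4 E3 E2 E1.
have a0' : 2 * a - t != 0 by rewrite -oppr_eq0 opprB.
(* P_n and its derivative occur only multiplied by beta_(n+1); solving for these
   products needs no division by it. *)
have bq : b * q = (x * p' - (N - 2 * b) * p) / (2 * x - t + 2 * a).
  by rewrite E1; field.
have bc : b * (2 * c - t)
    = (N - 2 * b) * (N - 2 * b + lambda) / (2 * a - t).
  by rewrite -E4; field.
have bq' : b * q' = ((2 * x * x - t * x - (lambda + N - 2 * b)) * (b * q)
     - (2 * x * b + b * (2 * c - t)) * p) / x.
  apply: (mulIf x0); have -> : b * q' * x = b * (x * q') by ring.
  rewrite E3; field.
  exact: x0.
have -> : p'' = ((N - 2 * b) * p' + 2 * (b * q)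
     + (2 * x - t + 2 * a) * (b * q') - p') / x.
  apply: (mulIf x0); have -> : p'' * x = p' + x * p'' - p' by ring.
  rewrite E2; field.
  exact: x0.
rewrite bq' bc bq; field.
by rewrite A0 x0 a0 a0'.
Qed.

End orthogonal.

(** * Derivative and boundary values of a polynomial times the weight *)

Section weight.
Context {R : realType}.
Variables lambda t : R.
Hypothesis lambda_gt0 : 0 < lambda.
Local Notation w := (laguerre_weight lambda t).
Local Notation mu := (@lebesgue_measure R).

Lemma weight_gt0 x : 0 < x -> 0 < w x.
Proof. by move=> x0; rewrite mulr_gt0 ?powR_gt0 ?expR_gt0. Qed.

Lemma is_derive_poly_weight (q : {poly R}) (x : R) : 0 < x ->
  is_derive x 1 (fun y => q.[y] * w y)
    ((q^`().[x] + (lambda / x + t - 2 * x) * q.[x]) * w x).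
Proof.
move=> x0.
have dpow := @is_derive1_powR R lambda x x0.
pose e : {poly R} := - 'X ^+ 2 + t *: 'X.
have eE y : e.[y] = - y ^+ 2 + t * y by rewrite !hornerE.
have dexp := is_derive1_comp (is_derive_expR e.[x]) (is_derive_poly e x).
have := is_deriveM (is_derive_poly q x) (is_deriveM dpow dexp).
have -> : horner q * ((@powR R)^~ lambda * (expR \o horner e))
  = (fun y => q.[y] * w y).
  by apply/funext => y; rewrite /laguerre_weight -eE.
move/is_derive_eq; apply.
rewrite /laguerre_weight /= -eE /GRing.scale/=.
rewrite powRB; last by rewrite (gt_eqF x0) implybT.
have -> : ((@powR R)^~ lambda * (expR \o horner e)) x
  = x `^ lambda * expR e.[x] by [].
rewrite powRr1 ?ltW// /e !(poly.derivE, hornerE)/=; field.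
by rewrite gt_eqF.
Qed.

Lemma poly_weight_continuous (q : {poly R}) (x : R) : 0 < x ->
  {for x, continuous (fun y => q.[y] * w y)}.
Proof.
move=> x0; apply/differentiable_continuous/derivable1_diffP.
by have [] := is_derive_poly_weight q x x0.
Qed.

Lemma poly_weight_within (q : {poly R}) (a b : R) : 0 < a ->
  {within `[a, b], continuous (fun x => q.[x] * w x)}.
Proof.
move=> a0; apply: continuous_in_subspaceT => x.
rewrite inE/= in_itv/= => /andP[ax _].
exact/poly_weight_continuous/(lt_le_trans a0 ax).
Qed.

(** The part of (q w)' that is not a polynomial times w. *)
Lemma poly_weight_div_within (q : {poly R}) (a b : R) : 0 < a ->
  {within `[a, b], continuous (fun x => lambda / x * q.[x] * w x)}.
Proof.
move=> a0; apply: continuous_in_subspaceT => x.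
rewrite inE/= in_itv/= => /andP[ax _].
have x0 := lt_le_trans a0 ax.
have -> : (fun x => lambda / x * q.[x] * w x)
    = (fun x => lambda / x * (q.[x] * w x)).
  by apply/funext => y; rewrite -!mulrA.
apply: cvgM; last exact: poly_weight_continuous.
apply: cvgM; first exact: cvg_cst.
by apply: cvgV; [rewrite gt_eqF|exact: cvg_id].
Qed.

Lemma weight_derivative_within (q : {poly R}) (a b : R) : 0 < a ->
  {within `[a, b], continuous
    (fun x => (q^`().[x] + (lambda / x + t - 2 * x) * q.[x]) * w x)}.
Proof.
move=> a0.
have -> : (fun x => (q^`().[x] + (lambda / x + t - 2 * x) * q.[x]) * w x)
   = (fun x => (q^`() + (t%:P - 2 *: 'X) * q).[x] * w x)
     \+ (fun x => lambda / x * q.[x] * w x).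
  apply/funext => x /=.
  rewrite !(hornerD, hornerM, hornerN, hornerZ, hornerC, hornerX); ring.
move=> x; apply: cvgD; first exact: poly_weight_within.
exact: poly_weight_div_within.
Qed.

Lemma poly_weight_FTC2 (q : {poly R}) (a b : R) : 0 < a -> a < b ->
  \int[mu]_(x in `[a, b])
    ((q^`().[x] + (lambda / x + t - 2 * x) * q.[x]) * w x)
  = q.[b] * w b - q.[a] * w a.
Proof.
move=> a0 ab; rewrite /Rintegral.
rewrite (@continuous_FTC2 _ _ (fun x => q.[x] * w x))//.
- exact: weight_derivative_within.
- split => [x /[!in_itv]/= /andP[ax _]||].
  + by have [] := is_derive_poly_weight q x (lt_trans a0 ax).
  + exact/cvg_at_right_filter/poly_weight_continuous.
  + exact/cvg_at_left_filter/poly_weight_continuous/(lt_trans a0).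
- move=> x /[!in_itv]/= /andP[ax _]; rewrite derive1E.
  by have [_ ->] := is_derive_poly_weight q x (lt_trans a0 ax).
Qed.

(** Here the positivity of lambda is essential: x^lambda tends to 0. *)
Lemma poly_weight_cvg0 (q : {poly R}) : q.[x] * w x @[x --> 0^'+] --> 0.
Proof.
have E : q.[0] * (0 * expR (- 0 ^+ 2 + t * 0)) = 0 by rewrite mul0r mulr0.
rewrite -[X in _ --> X]E.
apply: cvgM.
  by apply: cvg_at_right_filter; exact: continuous_horner.
apply: cvgM; first exact: powR_cvg0.
apply: (@cvg_at_right_filter _ _ (fun x : R => expR (- x ^+ 2 + t * x))).
apply: continuous_comp; last exact: continuous_expR.
apply: cvgD; first by apply: cvgN; exact: exprn_continuous.
exact: mulrl_continuous.
Qed.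

(** For x >= 1, x^lambda is at most a power x^m, and
    -x^2 + t x <= (t+1)^2/4 - x; as e^x >= x^N / N! with N = n + m + 1, the
    product is at most a constant times 1/x. *)
Lemma monomial_weight_cvgy n : x ^+ n * w x @[x --> +oo] --> 0.
Proof.
pose m := Num.bound lambda.
pose N := (n + m).+1.
pose C := expR ((t + 1) ^+ 2 / 4) * N`!%:R.
apply: (@squeeze_cvgr _ _ _ _ (fun=> 0) (fun x => C * x^-1)).
- near=> x.
  have x1 : 1 <= x by near: x; exact: nbhs_pinfty_ge.
  have x0 : 0 < x by exact: lt_le_trans x1.
  apply/andP; split.
    by rewrite mulr_ge0 ?exprn_ge0 ?(ltW x0) ?(ltW (weight_gt0 _ x0)).
  have pw : x `^ lambda <= x ^+ m.
    rewrite -powR_mulrn ?(ltW x0)// ler_powR//.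
    exact/ltW/archi_boundP/ltW.
  have ew : expR (- x ^+ 2 + t * x)
      <= expR ((t + 1) ^+ 2 / 4) * (N`!%:R / x ^+ N).
    apply: (@le_trans _ _ (expR ((t + 1) ^+ 2 / 4 - x))).
      by rewrite ler_expR; have := sqr_ge0 (x - (t + 1) / 2); nra.
    rewrite expRD ler_pM2l ?expR_gt0// expRN -[X in _ <= X]invrK.
    rewrite lef_pV2 ?posrE ?invr_gt0 ?divr_gt0 ?expR_gt0 ?exprn_gt0 ?ltr0n//;
      last exact: fact_gt0.
    rewrite invf_div; apply: le_trans (expR_ge1Dxn (n + m) (ltW x0)).
    by rewrite lerDr.
  apply: (@le_trans _ _ (x ^+ n * (x ^+ m *
      (expR ((t + 1) ^+ 2 / 4) * (N`!%:R / x ^+ N))))).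
    by rewrite ler_pM2l ?exprn_gt0// ler_pM ?powR_ge0 ?expR_ge0.
  rewrite le_eqVlt; apply/orP; left; apply/eqP.
  have -> : x ^+ N = x * (x ^+ n * x ^+ m) by rewrite exprS exprD.
  rewrite /C; field.
  by rewrite !expf_neq0 ?(gt_eqF x0).
- exact: cvg_cst.
- rewrite -[X in _ --> X](mulr0 C); apply: cvgM; first exact: cvg_cst.
  apply/cvgrPdist_le => _/posnumP[e]; near=> x.
  have x0 : 0 < x by near: x; exact: nbhs_pinfty_gt.
  rewrite distrC subr0 ger0_norm ?invr_ge0 ?(ltW x0)//.
  rewrite -lef_pV2 ?qualifE/= ?invr_gt0//.
  by rewrite invrK; near: x; apply: nbhs_pinfty_ge.
Unshelve. all: by end_near. Qed.

Lemma poly_weight_cvgy (q : {poly R}) : q.[x] * w x @[x --> +oo] --> 0.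
Proof.
(* The extra factor x ^+ n is what the Horner induction needs. *)
have H n : q.[x] * x ^+ n * w x @[x --> +oo] --> 0.
  elim/poly_ind: q n => [|p c IH] n.
    by under eq_fun do rewrite horner0 !mul0r; exact: cvg_cst.
  have -> : (fun x => (p * 'X + c%:P).[x] * x ^+ n * w x)
     = (fun x => p.[x] * x ^+ n.+1 * w x + c * (x ^+ n * w x)).
    by apply/funext => x; rewrite hornerMXaddC exprS; ring.
  rewrite -[X in _ --> X]addr0; apply: cvgD; first exact: IH.
  rewrite -[X in _ --> X](mulr0 c); apply: cvgM; first exact: cvg_cst.
  exact: monomial_weight_cvgy.
by have := H 0%N; under eq_fun do rewrite expr0 mulr1.
Qed.

(** * Moments of the weight *)

Lemma measurable_poly_weight (q : {poly R}) :
  measurable_fun setT (fun x => q.[x] * w x).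
Proof.
apply: measurable_funM; first exact: measurable_poly.
apply: measurable_funM; first exact: measurable_powR.
apply: measurableT_comp; first exact: measurable_expR.
have -> : (fun x : R => - x ^+ 2 + t * x) = horner (- 'X ^+ 2 + t *: 'X).
  by apply/funext => x; rewrite !hornerE.
exact: measurable_poly.
Qed.

(** A finite value of the integral implies that the positive and the negative
    part both have finite integrals. *)
Lemma integrable_poly_weight_fin_num (q : {poly R}) :
  (\int[mu]_(x in `]0%R, +oo[) (q.[x] * w x)%:E)%E \is a fin_num ->
  mu.-integrable `]0, +oo[ (fun x => (q.[x] * w x)%:E).
Proof.
have mq : measurable_fun (`]0%R, +oo[ : set R) (fun x => q.[x] * w x).
  by apply: measurable_funTS; exact: measurable_poly_weight.
move=> fq; apply/integrableP; split; first exact/measurable_EFinP.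
by rewrite integral_fin_num_abs.
Qed.

Definition moment (q : {poly R}) : R :=
  \int[mu]_(x in `]0, +oo[) (q.[x] * w x).

Hypothesis integrable_poly_weight : forall q : {poly R},
  mu.-integrable `]0, +oo[ (fun x => (q.[x] * w x)%:E).

Lemma moment_is_scalar : scalar moment.
Proof.
move=> a p q; rewrite /moment.
under eq_Rintegral do rewrite hornerD hornerZ mulrDl -mulrA.
have iap : mu.-integrable `]0, +oo[ (EFin \o (fun x => a * (p.[x] * w x))).
  apply: eq_integrable (integrable_poly_weight (a *: p)) => // x _.
  by rewrite hornerZ /= mulrA.
rewrite RintegralD//; last exact: integrable_poly_weight.
by rewrite RintegralZl//; exact: integrable_poly_weight.
Qed.

(** Dominated convergence for the restrictions to [1/(n+1), n+2]; the bound n+2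
    makes the interval nondegenerate for n = 0 too. *)
Lemma moment_cvg (q : {poly R}) :
  \int[mu]_(x in `[n.+1%:R^-1, n.+2%:R]) (q.[x] * w x) @[n --> \oo]
    --> moment q.
Proof.
pose f n := EFin \o ((fun x => q.[x] * w x) \_ `[n.+1%:R^-1, n.+2%:R]).
have mf n : measurable_fun (`]0%R, +oo[ : set R) (f n).
  apply/measurable_EFinP; apply: measurable_funTS.
  apply/(measurable_restrictT _ _).1 => //.
  by apply: measurable_funTS; exact: measurable_poly_weight.
have [| | | |_ _] := @dominated_convergence _ _ R mu (`]0%R, +oo[ : set R)
  (measurable_itv _)
  f (fun x => (q.[x] * w x)%:E) (fun x => `|(q.[x] * w x)%:E|%E) mf.
- apply/measurable_EFinP; apply: measurable_funTS.
  exact: measurable_poly_weight.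
- apply: aeW => x; rewrite /= in_itv/= andbT => x0.
  apply: cvg_near_cst; near=> n.
  rewrite /f/= patchE mem_set//= in_itv/=; apply/andP; split.
    rewrite -[leRHS]invrK lef_pV2 ?posrE ?invr_gt0 ?ltr0n//.
    rewrite (le_trans (ltW (archi_boundP _))) ?invr_ge0 ?(ltW x0)// ler_nat.
    by apply: leqW; near: n; exact: nbhs_infty_ge.
  rewrite (le_trans (ltW (archi_boundP (ltW x0))))// ler_nat.
  by apply/leqW/leqW; near: n; exact: nbhs_infty_ge.
- apply/integrable_abse; exact: integrable_poly_weight.
- apply: aeW => x n _; rewrite /f /= patchE; case: ifPn => // _.
  by have -> : (point : R) = 0 by []; rewrite normr0 lee_fin.
- rewrite -[X in _ --> X]fineK; last first.
    exact: integrable_fin_num (integrable_poly_weight q).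
  move/fine_cvg; apply: cvg_trans; apply: near_eq_cvg; apply: nearW => n /=.
  transitivity (\int[mu]_(x in `]0%R, +oo[ `&` `[n.+1%:R^-1, n.+2%:R])
      (q.[x] * w x)); first exact/esym/Rintegral_mkcondr.
  congr (Rintegral _ _ _); apply/seteqP; split => x /=.
    by move=> [].
  rewrite !in_itv/= => /andP[nx xn]; split; last by rewrite nx.
  by rewrite andbT (lt_le_trans _ nx)// invr_gt0.
Unshelve. all: by end_near. Qed.

(** The integral equals the increment of q w, which vanishes at both ends.  The
    integrand lambda q w / x, possibly singular at 0, is kept inside compact
    intervals, so no integrability near 0 has to be established. *)
Lemma weight_derivative_cvg0 (q : {poly R}) :
  \int[mu]_(x in `[n.+1%:R^-1, n.+2%:R])
    ((q^`().[x] + (lambda / x + t - 2 * x) * q.[x]) * w x) @[n --> \oo] --> 0.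
Proof.
have a0 n : 0 < n.+1%:R^-1 :> R by rewrite invr_gt0.
have ab n : n.+1%:R^-1 < n.+2%:R :> R.
  by rewrite (@le_lt_trans _ _ 1) ?invf_le1 ?ler1n// ltr1n.
suff H : q.[n.+2%:R] * w n.+2%:R - q.[n.+1%:R^-1] * w n.+1%:R^-1
    @[n --> \oo] --> (0 : R).
  apply: cvg_trans H; apply: near_eq_cvg; apply: nearW => n.
  by rewrite poly_weight_FTC2.
rewrite -[X in _ --> X](subr0 0); apply: cvgB.
  apply: (cvg_comp _ _ _ (poly_weight_cvgy q)).
  apply: (cvg_comp _ _ _ (@cvgr_idn R)).
  exact: (cvg_addnl 2).
apply: (cvg_at_rightP _ _ _).1 (poly_weight_cvg0 q) _ _; split => //.
exact: cvg_harmonic.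
Qed.

(** For the product x q the singular factor lambda / x cancels, and the limit of
    the integrals is a moment. *)
Lemma pearson (q : {poly R}) :
  moment ('X * q^`() + ((1 + lambda)%:P + t *: 'X - 2 *: 'X ^+ 2) * q) = 0.
Proof.
set r := (X in moment X).
have qr : \int[mu]_(x in `[n.+1%:R^-1, n.+2%:R])
    ((('X * q)^`().[x] + (lambda / x + t - 2 * x) * ('X * q).[x]) * w x)
    @[n --> \oo] --> moment r.
  apply: cvg_trans (moment_cvg r); apply: near_eq_cvg; apply: nearW => n.
  apply: eq_Rintegral => x /[!inE]/= /[!in_itv]/= /andP[nx _].
  congr (_ * _); rewrite /r poly.derivM poly.derivX.
  rewrite !(hornerD, hornerM, hornerN, hornerZ, hornerC, hornerX, hornerXn).
  by field; rewrite gt_eqF// (lt_le_trans _ nx)// invr_gt0.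
by have := cvg_unique _ qr (weight_derivative_cvg0 ('X * q)); apply.
Qed.

(** On growing intervals the integrals of (p^2)' + (t - 2 x) p^2 and of
    lambda p^2 / x against w have a sum tending to 0, and the second one is
    bounded below by a positive constant: p >= 1 beyond some M, so that lambda p^2 w / x has a positive
    minimum on [M, M+1]. *)
Lemma moment_square_lt0 (p : {poly R}) : p \is monic ->
  moment ((p ^+ 2)^`() + (t%:P - 2 *: 'X) * p ^+ 2) < 0.
Proof.
move=> /monicP lp.
have [M0 pM0] : exists M, forall x, M <= x -> 1 <= p.[x].
  by have := @polyrcf.poly_pinfty_gt_lc R p; rewrite lp; apply.
pose M := Num.max M0 1.
have M1 : 1 <= M by rewrite le_max lexx orbT.
have M_gt0 : 0 < M := lt_le_trans ltr01 M1.
have MM : M <= M + 1 by rewrite lerDl.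
pose g x := lambda / x * (p ^+ 2).[x] * w x.
have g_ge0 x : 0 < x -> 0 <= g x.
  move=> x0; apply: mulr_ge0; last exact/ltW/weight_gt0.
  by rewrite horner_exp mulr_ge0 ?sqr_ge0// divr_ge0 ?ltW.
have [c cM gc] := EVT_min MM (poly_weight_div_within (p ^+ 2) M (M + 1) M_gt0).
move: cM; rewrite in_itv/= => /andP[Mc _].
have c0 := lt_le_trans M_gt0 Mc.
have gc_gt0 : 0 < g c.
  apply: mulr_gt0; last exact: weight_gt0.
  rewrite horner_exp mulr_gt0 ?divr_gt0// exprn_gt0//.
  by rewrite (lt_le_trans ltr01)// pM0// (le_trans _ Mc)// le_max lexx.
have igM : mu.-integrable `[M, M + 1] (EFin \o g).
  apply: continuous_compact_integrable; first exact: segment_compact.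
  exact: poly_weight_div_within.
set r := (X in moment X).
have ig n : mu.-integrable `[n.+1%:R^-1, n.+2%:R] (EFin \o g).
  apply: continuous_compact_integrable; first exact: segment_compact.
  by apply: poly_weight_div_within; rewrite invr_gt0.
have ir n : mu.-integrable `[n.+1%:R^-1, n.+2%:R]
    (EFin \o (fun x => r.[x] * w x)).
  apply: continuous_compact_integrable; first exact: segment_compact.
  by apply: poly_weight_within; rewrite invr_gt0.
have gI : \forall n \near \oo,
    g c <= \int[mu]_(x in `[n.+1%:R^-1, n.+2%:R]) g x.
  near=> n.
  have nM : n.+1%:R^-1 <= M.
    by rewrite (le_trans _ M1)// invf_le1 ?ler1n.
  have Mn : M + 1 <= n.+2%:R.
    rewrite -[n.+2%:R]natr1 lerD2r.
    rewrite (le_trans (ltW (archi_boundP (ltW M_gt0))))// ler_nat.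
    by apply/leqW; near: n; exact: nbhs_infty_ge.
  have sub : `[M, M + 1] `<=` `[n.+1%:R^-1, n.+2%:R].
    by apply: subset_itvScc; rewrite bnd_simp.
  apply: (@le_trans _ _ (\int[mu]_(x in `[M, M + 1]) g x)).
    have -> : g c = \int[mu]_(x in `[M, M + 1]) (cst (g c) x).
      rewrite Rintegral_cst//= lebesgue_measure_itv/= lte_fin ltrDl ltr01.
      by rewrite -EFinD/= [M + 1]addrC addrK mulr1.
    apply: le_Rintegral => //.
    apply: continuous_compact_integrable; first exact: segment_compact.
    by move=> x; exact: cvg_cst.
  rewrite /Rintegral fine_le//.
  - exact: integrable_fin_num igM.
  - exact: integrable_fin_num (ig n).
  - apply: ge0_subset_integral => //; first exact: measurable_int (ig n).
    move=> x /= /[!in_itv]/= /andP[nx _].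
    by rewrite lee_fin g_ge0// (lt_le_trans _ nx)// invr_gt0.
suff : g c <= 0 - moment r by lra.
apply: (cvgr_to_ge (cvgB (weight_derivative_cvg0 (p ^+ 2)) (moment_cvg r))).
near=> n.
rewrite !fctE.
have -> : \int[mu]_(x in `[n.+1%:R^-1, n.+2%:R])
    (((p ^+ 2)^`().[x] + (lambda / x + t - 2 * x) * (p ^+ 2).[x]) * w x)
  = \int[mu]_(x in `[n.+1%:R^-1, n.+2%:R]) (g x + r.[x] * w x).
  apply: eq_Rintegral => x _; rewrite /g -mulrDl; congr (_ * _); rewrite /r.
  rewrite !(hornerD, hornerM, hornerN, hornerZ, hornerC, hornerX); ring.
rewrite RintegralD// addrK.
by near: n.
Unshelve. all: by end_near. Qed.

End weight.

(** Each P_k w has the finite integral of P_0 P_k w, because P_0 = 1; the P_k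
    span the polynomials. *)
Lemma integrable_poly_weight {R : realType} (lambda t : R)
    (P : nat -> {poly R}) (h : nat -> R) :
  monic_orthogonal (laguerre_weight lambda t) P h -> forall q : {poly R},
  (@lebesgue_measure R).-integrable `]0, +oo[
    (fun x => (q.[x] * laguerre_weight lambda t x)%:E).
Proof.
move=> [P_monic P_int] q.
have iP k : (@lebesgue_measure R).-integrable `]0, +oo[
    (fun x => ((P k).[x] * laguerre_weight lambda t x)%:E).
  apply: integrable_poly_weight_fin_num.
  have := P_int 0%N k; have [/monicP + s0] := P_monic 0%N.
  rewrite (size1_polyC (eq_leq s0)) lead_coefC => ->.
  by under eq_integral do rewrite hornerC mul1r; move=> ->.
suff H k (p : {poly R}) : (size p <= k)%N ->
    (@lebesgue_measure R).-integrable `]0, +oo[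
      (fun x => (p.[x] * laguerre_weight lambda t x)%:E) by exact: (H (size q)).
elim: k p => [p|k IH p sp].
  rewrite size_poly_leq0 => /eqP ->.
  apply: eq_integrable (integrable0 _ _) => // x _.
  by rewrite horner0 mul0r.
apply: eq_integrable (integrableD _ (IH _ (size_sub_monic_seq P P_monic k p sp))
  (integrableZl _ p`_k (iP k))) => // x _.
by rewrite /= -EFinM -EFinD hornerD hornerN hornerZ; congr (_%:E); ring.
Qed.

(** * The differential equation *)

Theorem theorem1p3 (R : realType) (lambda t : R) (P : nat -> {poly R})
    (h alpha beta : nat -> R)
    (lambda_gt0 : 0 < lambda)
    (P_orthogonal : monic_orthogonal (laguerre_weight lambda t) P h)
    (P_recurrence : three_term_recurrence P alpha beta)
    (n : nat) :
  t - 2 * alpha n != 0 /\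
  forall x : R, x != 0 -> 2 * x - t + 2 * alpha n != 0 ->
    (P n)^`()^`().[x]
    + Phi lambda t alpha n x * (P n)^`().[x]
    + Psi lambda t alpha beta n x * (P n).[x] = 0.
Proof.
have [P_monic P_int] := P_orthogonal.
have int_w := integrable_poly_weight lambda t P h P_orthogonal.
pose L : {scalar {poly R}} := HB.pack (moment lambda t)
  (GRing.isLinear.Build _ _ _ _ _ (moment_is_scalar lambda t int_w)).
have L_orth i j : L (P i * P j) = if i == j then h j else 0.
  rewrite /L/= /moment /Rintegral; under eq_integral do rewrite hornerM.
  by rewrite P_int.
have L_pearson := pearson lambda t lambda_gt0 int_w.
have ah_lt0 k : (t - 2 * alpha k) * h k < 0.
  rewrite -(L_square_derivative L P h P_monic L_orth alpha beta P_recurrence).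
  exact: moment_square_lt0 (P_monic k).1.
have h_neq0 k : h k != 0.
  by apply: contraTneq (ah_lt0 k) => ->; rewrite mulr0 ltxx.
have a_neq0 : t - 2 * alpha n != 0.
  by apply: contraTneq (ah_lt0 n) => ->; rewrite mul0r ltxx.
split=> // x x0 A0.
exact: (second_order_equation L P h).
Qed.
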